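(* Let $p\ge 0$ be a real number, $k\ge 1$ an integer, and $n$ an integer with $n\ge (p+1)k$. Then $|\mathit{Gen}_p(n,k)|=n-k+1-\lceil p\rceil$.
   Context: The weight of a binary word is its number of 1's. For a real $p\ge 0$ and integers $k\ge 0$, $n\ge (p+1)k$, $C_n(p,k)$ is the set of binary words of length $n$ and weight $k$ such that in every prefix the number of 0's is at least $p$ times the number of 1's. A homogeneous transposition of a binary word exchanges a 1 and a 0 such that no 1 occurs strictly between the two exchanged positions. For a set $S$ of binary words of the same length and weight and $\alpha\in S$, the list obtained by applying the greedy algorithm for $S$ to $\alpha$ is built as follows: start with the list $(\alpha)$; repeatedly, for the last word $w$ of the current list, among all words obtainable from $w$ by one homogeneous transposition that lie in $S$ and do not already occur in the list, choose the one obtained by transposing the leftmost possible 1 with (among transpositions of that 1) the leftmost possible 0, and append it; stop when no such word exists. $\mathcal{D}_p(\alpha)$ denotes the list obtained by applying the greedy algorithm for $C_n(p,k)$ to $\alpha\in C_n(p,k)$, and $\mathit{Gen}_p(n,k)$ is the set of $\alpha\in C_n(p,k)$ such that $\mathcal{D}_p(\alpha)$ contains every word of $C_n(p,k)$. *)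

(* Defs.v *)
From mathcomp Require Import all_boot all_order all_algebra.
From mathcomp Require Import reals.
Set Implicit Arguments. Unset Strict Implicit. Unset Printing Implicit Defensive.
Import Order.TTheory GRing.Theory Num.Theory.

Definition weight (w : seq bool) : nat := count id w.
Definition zeros (w : seq bool) : nat := count negb w.

Definition inC (R : realType) (p : R) (n k : nat) (w : seq bool) : bool :=
  [&& size w == n, weight w == k &
      all (fun m => p * (weight (take m w))%:R <= (zeros (take m w))%:R)%R
          (iota 0 (size w).+1)].

Definition swap (w : seq bool) (i j : nat) : seq bool :=
  set_nth false (set_nth false w i (nth false w j)) j (nth false w i).

Definition homog (w : seq bool) (i j : nat) : bool :=
  [&& i < size w, j < size w, nth false w i, ~~ nth false w j &
      all (fun m => ~~ nth false w m) (iota (minn i j).+1 ((maxn i j) - (minn i j)).-1)].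

(* all pairs (i,j) ordered lexicographically: leftmost 1 first, then leftmost 0 *)
Definition pairs (n : nat) : seq (nat * nat) :=
  [seq (i, j) | i <- iota 0 n, j <- iota 0 n].

Definition greedy_next (S : pred (seq bool)) (L : seq (seq bool)) (w : seq bool)
  : option (seq bool) :=
  let ok ij := [&& homog w ij.1 ij.2, S (swap w ij.1 ij.2) & swap w ij.1 ij.2 \notin L] in
  ohead [seq swap w ij.1 ij.2 | ij <- pairs (size w) & ok ij].

Fixpoint greedy_aux (S : pred (seq bool)) (fuel : nat) (L : seq (seq bool)) (w : seq bool)
  : seq (seq bool) :=
  match fuel with
  | 0 => L
  | f.+1 => match greedy_next S L w with
            | None => L
            | Some w' => greedy_aux S f (rcons L w') w'
            end
  end.

(* The greedy algorithm for S applied to alpha.  All words in the list are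
   distinct words of length size alpha, so 2^(size alpha) steps of fuel
   suffice for the algorithm to stop on its own. *)
Definition greedy (S : pred (seq bool)) (alpha : seq bool) : seq (seq bool) :=
  greedy_aux S (2 ^ size alpha) [:: alpha] alpha.

Definition Dp (R : realType) (p : R) (n k : nat) (alpha : seq bool) :=
  greedy (inC p n k) alpha.

Definition Gen (R : realType) (p : R) (n k : nat) : {set n.-tuple bool} :=
  [set a : n.-tuple bool | inC p n k a &&
     [forall w : n.-tuple bool, inC p n k w ==> (val w \in Dp p n k a)]].

(* Main.v *)
Require Import Defs.
From mathcomp Require Import all_boot all_order all_algebra.
From mathcomp Require Import reals zify.
From mathcomp.classical Require Import boolp.
Import Order.TTheory GRing.Theory Num.Theory.

Set Implicit Arguments. Unset Strict Implicit. Unset Printing Implicit Defensive.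

(** Encode a word by the decreasing list [c_k; ...; c_1] of the positions of
    its 1's; membership in C_n(p,k) means c_i >= l_i for a strictly increasing
    sequence l.  The greedy algorithm moves the last 1 only when the prefix
    before it is stuck, so a run splits into "levels" (values of c_k), and inside
    a level it is a greedy run for k-1.  By induction on k: a run covers
    everything iff c_2, ..., c_k are each as far left as c_1 allows ("tight"
    words); a run not started at the rightmost word ends at the rightmost word;
    and the run started at the rightmost word of length n ends, for k odd, at the
    rightmost word of length n-1 (if it exists) and, for k even, at a tight word
    with c_k minimal.  A tight word is determined by c_1, which ranges over
    l_1, ..., n-k. *)

(** * Greedy runs on position lists *)

Lemma ohead_filter_iota (P : pred nat) a m y :
  a <= y < a + m -> P y -> (forall z, a <= z < y -> ~~ P z) ->
  ohead [seq z <- iota a m | P z] = Some y.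
Proof.
move=> y_am Py minP; have ->: m = (y - a) + (m - (y - a)).-1.+1 by lia.
rewrite iotaD filter_cat /= subnKC ?Py; last by lia.
rewrite (_ : filter _ _ = [::]) //; apply/eqP; rewrite -size_eq0 size_filter.
rewrite -leqn0 leqNgt -has_count; apply/hasPn => z; rewrite mem_iota => zP.
by apply: minP; lia.
Qed.

Section Positions.

Variable l : nat -> nat.
Hypothesis ltlS : forall i, l i < l i.+1.

Notation pword := (seq nat).
Implicit Types (r s q e : pword) (V : pred pword) (t T : seq pword).

(** An entry with [i] entries after it is the position of the 1 that has [i] 1's to its left, so the
    bounds [l] are indexed from zero. Each entry bounds the next one, hence the list is strictly
    decreasing. *)
Fixpoint valid n r :=
  if r is x :: r' then [&& x < n, l (size r') <= x & valid x r'] else true.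

Definition past_head r := if r is x :: _ then x.+1 else 0.
Definition leftmost r := maxn (l (size r)) (past_head r).

(** A 1 cannot cross its neighbours, so moves of the prefix stay below [x]; they come first because
    the leftmost 1 has priority. Moves of the last 1 are listed by increasing target. *)
Fixpoint moves_pos n r :=
  if r is x :: r' then
    map (cons x) (moves_pos x r') ++
    [seq y :: r' | y <- iota (leftmost r') (n - leftmost r') & y != x]
  else [::].

Definition next_pos n V r := ohead [seq s <- moves_pos n r | ~~ V s].

Definition visit V t : pred pword := fun u => V u || (u \in t).

(** [t] lists the words chosen after [r]; it need not reach the point where the algorithm stops. *)
Fixpoint trace n V r t :=
  if t is s :: t' then
    next_pos n V r = Some s /\ trace n (visit V [:: s]) s t'
  else True.

(* Each 1 except the first is as far left as the 1's before it allow. *)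
Fixpoint tight r :=
  if r is x :: r' then (r' == [::]) || ((x == leftmost r') && tight r') else true.

Fixpoint latest n k := if k is k'.+1 then n.-1 :: latest n.-1 k' else [::].

Definition full n k T := forall s, size s = k -> valid n s -> s \in T.
(** The exceptional case in which a run can both start and end at the rightmost word. *)
Definition single n k := forall s, size s = k -> valid n s -> s = latest n k.

(** * Elementary facts on valid lists and their moves *)

Lemma valid_leq n m r : valid n r -> n <= m -> valid m r.
Proof. by case: r => //= x r /and3P[? -> ->] ?; rewrite andbT; lia. Qed.

Lemma valid_past_head n r : valid n r -> past_head r <= n.
Proof. by case: r => //= x r /and3P[]. Qed.

Lemma valid_le_past_head n m r : valid n r -> past_head r <= m -> valid m r.
Proof. by case: r => //= x r /and3P[_ -> ->] ->. Qed.

Lemma valid_gt0 n r : 0 < size r -> valid n r -> 0 < n.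
Proof. by case: r => //= x r _ /and3P[]; case: n. Qed.

Lemma valid_size n r : valid n r -> size r <= n.
Proof. by elim: r n => //= x r IH n /and3P[xn _ /IH]; lia. Qed.

Lemma size_latest n k : size (latest n k) = k.
Proof. by elim: k n => //= k IH n; rewrite IH. Qed.

Lemma valid_latest n r : valid n r -> valid n (latest n (size r)).
Proof.
elim: r n => //= x r IH n /and3P[xn lx Cr]; rewrite size_latest.
by rewrite (IH n.-1) ?(valid_leq Cr) ?andbT; lia.
Qed.

Lemma past_head_latest n k : 0 < k -> 0 < n -> past_head (latest n k) = n.
Proof. by case: k => // k _ /=; case: n. Qed.

Lemma tight_latest n k : valid n (latest n k) -> tight (latest n k).
Proof.
elim: k n => //= k IH n /and3P[_ ln Cn]; rewrite (IH _ Cn) andbT.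
case: k {IH} ln Cn => //= k ln /and3P[] nn _ _; rewrite /leftmost /= size_latest.
by rewrite /= size_latest in ln; lia.
Qed.

Lemma moves_pos_valid n r s : valid n r -> s \in moves_pos n r -> valid n s && (size s == size r).
Proof.
elim: r n s => //= x r IH n s /and3P[xn lx Cr]; rewrite mem_cat.
case/orP=> /mapP[y].
  by move=> /(IH _ _ Cr) /andP[Cy /eqP sy] ->; rewrite /= sy xn lx Cy eqxx.
rewrite mem_filter mem_iota => /andP[_ yP] ->; rewrite /= eqxx andbT.
rewrite /leftmost in yP; have -> : y < n by lia.
by rewrite (valid_le_past_head Cr) ?andbT; lia.
Qed.

Lemma next_pos_Some n V r s : next_pos n V r = Some s -> s \in moves_pos n r /\ ~~ V s.
Proof.
rewrite /next_pos; case E: [seq _ <- _ | _] => [|u t] //= [us]; subst u.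
by have := mem_head s t; rewrite -E mem_filter => /andP[].
Qed.

(** Prefix moves take priority, and the last 1 moves only when the prefix has no unvisited move.
    This is what splits a run into levels. *)
Lemma next_pos_cons n V x r :
  next_pos n V (x :: r) =
  if next_pos x (fun s => V (x :: s)) r is Some s then Some (x :: s)
  else ohead [seq y :: r | y <- iota (leftmost r) (n - leftmost r)
                         & (y != x) && ~~ V (y :: r)].
Proof.
rewrite /next_pos /= filter_cat filter_map.
rewrite (eq_filter (a2 := fun s => ~~ V (x :: s))) //.
case: [seq _ <- _ | _] => //=; rewrite filter_map -filter_predI.
by congr (ohead (map _ _)); apply: eq_filter => y /=; rewrite andbC.
Qed.

(* [x] is the position of the last 1: no unvisited move keeps it in place. *)
Definition stuck V x q := next_pos x (fun s => V (x :: s)) q = None.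

Lemma next_pos_jump n V x q y : stuck V x q -> leftmost q <= y < n -> y != x ->
  ~~ V (y :: q) -> (forall z, leftmost q <= z < y -> V (z :: q)) ->
  next_pos n V (x :: q) = Some (y :: q).
Proof.
move=> st yn yx Vy minV; rewrite next_pos_cons st.
have : ohead [seq z <- iota (leftmost q) (n - leftmost q) | (z != x) && ~~ V (z :: q)] = Some y.
  apply: ohead_filter_iota; [lia|by rewrite yx|].
  by move=> z /minV ->; rewrite andbF.
by case: [seq _ <- _ | _] => //= a b [->].
Qed.

Lemma next_pos_None n V x q : stuck V x q ->
  (forall z, leftmost q <= z < n -> V (z :: q)) -> next_pos n V (x :: q) = None.
Proof.
move=> st allV; rewrite next_pos_cons st (_ : filter _ _ = [::]) //.
apply/eqP; rewrite -size_eq0 size_filter -leqn0 leqNgt -has_count.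
apply/hasPn => z; rewrite mem_iota => zP; rewrite allV ?andbF //; lia.
Qed.

(** * Visited sets and traces *)

Lemma visit0 V : visit V [::] = V.
Proof. by apply: funext => u; rewrite /visit orbF. Qed.

Lemma visit_cat V t T : visit (visit V t) T = visit V (t ++ T).
Proof. by apply: funext => u; rewrite /visit mem_cat orbA. Qed.

Lemma trace_cat n V r t T : trace n V r t ->
  trace n (visit V t) (last r t) T -> trace n V r (t ++ T).
Proof.
elim: t V r => [|s t IH] V r /=; first by rewrite visit0.
by case=> -> tr1 tr2; split=> //; apply: IH => //; rewrite visit_cat.
Qed.

(** While the last 1 stays at [x], the algorithm acts on the prefix as it would on words of length
    [x]. *)
Lemma trace_map n V x r t : trace x (fun s => V (x :: s)) r t ->
  trace n V (x :: r) (map (cons x) t).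
Proof.
elim: t V r => //= s t IH V r [ns tr]; split; first by rewrite next_pos_cons ns.
apply: IH; rewrite (_ : (fun u => _) = visit (fun u => V (x :: u)) [:: s]) //.
by apply: funext => u; rewrite /visit !inE eqseq_cons eqxx.
Qed.

Lemma trace_notin n V r t s : trace n V r t -> s \in t -> ~~ V s.
Proof.
elim: t V r => //= u t IH V r [/next_pos_Some[_ Vu] tr]; rewrite inE.
by case/predU1P=> [->|/(IH _ _ tr)] //; rewrite /visit negb_or => /andP[].
Qed.

Lemma trace_uniq n V r t : trace n V r t -> uniq t.
Proof.
elim: t V r => //= u t IH V r [_ tr]; rewrite (IH _ _ tr) andbT.
by apply/negP => /(trace_notin tr); rewrite /visit mem_head orbT.
Qed.

Lemma trace_valid n V r t s : valid n r -> trace n V r t -> s \in r :: t ->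
  valid n s /\ size s = size r.
Proof.
elim: t V r => [|u t IH] V r Cr /=; first by move=> _; rewrite inE => /eqP->.
case=> /next_pos_Some[/(moves_pos_valid Cr)/andP[Cu /eqP su] _] tr.
rewrite inE => /predU1P[->//|/(IH _ _ Cu tr)]; by rewrite su.
Qed.

(** * Complete runs and their passage from level to level *)

Definition run n r t :=
  trace n (pred1 r) r t /\ next_pos n (visit (pred1 r) t) (last r t) = None.

Lemma run_last n r t : valid n r -> run n r t ->
  valid n (last r t) /\ size (last r t) = size r.
Proof. by move=> Cr [tr _]; apply: (trace_valid Cr tr); apply: mem_last. Qed.

(** No word of level [y] is visited before the jump, so right after it only the landing word is, and
    the algorithm replays the run of [q] below [y]. *)
Lemma jump n V x q y t : stuck V x q -> leftmost q <= y < n -> y != x ->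
    (forall z, leftmost q <= z < y -> V (z :: q)) -> (forall s, V (y :: s) = false) ->
    run y q t ->
  trace n V (x :: q) (map (cons y) (q :: t)) /\
  stuck (visit V (map (cons y) (q :: t))) y (last q t).
Proof.
move=> st yn yx minV V0 [tr sT].
have E0 : (fun s => visit V [:: y :: q] (y :: s)) = pred1 q.
  by apply: funext => s; rewrite /visit V0 inE eqseq_cons eqxx.
split.
  split; first by apply: next_pos_jump; rewrite ?V0.
  by apply: trace_map; rewrite E0.
rewrite /stuck -[RHS]sT; congr (next_pos _ _ _); apply: funext => s.
by rewrite /visit V0 /= inE eqseq_cons eqxx /= mem_map // => ? ? [].
Qed.

(** [e] is the last word of the run started at the rightmost word of level [n];
    the two shapes of [e] alternate with the parity of [k]. *)
Definition endcond k n e :=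
  tight e /\ if odd k then (l k.-1 < n.-1 -> e = latest n.-1 k)
             else valid (l k) e /\ (e = latest (l k) k -> single (l k) k).

(** Coverage alone is not inductive: the prefix ending one level is the one starting the next, so
    end words are recorded as well. *)
Definition run_spec k := forall n r, size r = k -> valid n r ->
  exists t, [/\ run n r t, tight r <-> full n k (r :: t),
                r <> latest n k -> last r t = latest n k
              & r = latest n k -> endcond k n (last r t)].

Lemma visit_level V y t z s :
  visit V (map (cons y) t) (z :: s) = V (z :: s) || (z == y) && (s \in t).
Proof.
rewrite /visit; congr (_ || _); apply/mapP/andP; last first.
  by case=> /eqP-> st; exists s.
by case=> u ut [-> ->].
Qed.

(** A run started elsewhere ends at the rightmost word; one started there stays there when no other
    word exists. *)
Lemma run_spec_last k n r t : size r = k -> valid n r -> run n r t ->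
    (r <> latest n k -> last r t = latest n k) -> (r = latest n k -> single n k) ->
  last r t = latest n k.
Proof.
move=> sr Cr rt H1 H2; case: (r =P latest n k) => [/H2 h|/H1 //].
by have [Ce se] := run_last Cr rt; apply: h; rewrite ?se.
Qed.

(** For [k > 0] the premise fails: [q] lies below [x], while [latest x.+1 k] has a 1 at [x]. *)
Lemma single_latest k x q : size q = k -> valid x q -> q = latest x.+1 k -> single x.+1 k.
Proof.
move=> sq Cq e s ss _; have [k0|k0] := posnP k.
  by move: ss; rewrite k0 => /size0nil.
by have := valid_past_head Cq; rewrite e past_head_latest // ltnn.
Qed.

(** * Sweeps through consecutive levels *)

Ltac nat_lia := repeat match goal with
  | H : trace _ _ _ _ |- _ => clear H
  | H : stuck _ _ _ |- _ => clear H
  | H : run _ _ _ |- _ => clear H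
  | H : run_spec _ |- _ => clear H
  | H : endcond _ _ _ |- _ => clear H
  | H : is_true (valid _ _) |- _ => clear H
  | H : is_true (tight _) |- _ => clear H
  | H : @eq (seq nat) _ _ |- _ => clear H
  | H : @eq (option _) _ _ |- _ => clear H
  | H : _ <-> _ |- _ => clear H
  | H : _ /\ _ |- _ => clear H
  | H : ?P -> ?Q |- _ => clear H
  | H : forall _, _ |- _ => clear H
  end; lia.

(** Level [y] is fresh and [q] is tight, so the run below [y] covers the level and gets stuck at
    [latest y k]. The next unvisited place for the last 1 is then [y.+1], and [latest y k] is again
    a tight start, so the argument repeats up to [m.-1]. The level [x] left at the beginning may lie
    below or above the swept range. *)
Lemma climb k n m y V x q : run_spec k -> m <= n -> y < m -> size q = k ->
    valid y q -> l k <= y -> stuck V x q -> (x < y) || (m <= x) ->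
    (forall z, leftmost q <= z < y -> V (z :: q)) ->
    (forall z s, y <= z < m -> V (z :: s) = false) -> tight q ->
    (q = latest y k -> single y k) ->
  exists T, [/\ trace n V (x :: q) T, last (x :: q) T = latest m k.+1,
    stuck (visit V T) m.-1 (latest m.-1 k),
    forall z s, size s = k -> valid z s -> y <= z < m -> visit V T (z :: s)
  & forall z s, ~~ (y <= z < m) -> visit V T (z :: s) = V (z :: s)].
Proof.
move=> gk mn; have [d] := ubnP (m - y).
elim: d => // d IH in y V x q *.
move=> md ym sq Cq ly st xy minV V0 aq nl.
have [t [rt at_ l1 l2]] := gk _ _ sq Cq.
have [Ce se] := run_last Cq rt; rewrite sq in se.
have loq : leftmost q <= y by rewrite /leftmost sq geq_max ly valid_past_head.
have le := run_spec_last sq Cq rt l1 nl.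
have [|||] := @jump n V x q y t st _ _ minV _ rt.
- by nat_lia.
- by nat_lia.
- by move=> s; apply: V0; nat_lia.
set T := map _ _ => trT stT; rewrite le in stT Ce.
have lT : last (x :: q) T = y :: latest y k.
  by rewrite /T /= last_map le.
have fy s : size s = k -> valid y s -> s \in q :: t by apply: (proj1 at_ aq).
have [ym1|ym1] := eqVneq y.+1 m.
  exists T; split=> //; rewrite -?ym1 ?lT //=.
    move=> z s ss Cs /andP[yz zy]; have zE : z = y by nat_lia.
    by rewrite visit_level zE eqxx fy ?orbT // -zE.
  move=> z s zy; rewrite visit_level; case: eqVneq => [|_]; last by rewrite orbF.
  by move=> zE; nat_lia.
have [|||||||z zP|z s zP|||T' [tr' la' st' fu' ot']] := IH y.+1 (visit V T) y (latest y k).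
- nat_lia.
- nat_lia.
- exact: size_latest.
- exact: valid_leq Ce _.
- nat_lia.
- exact: stT.
- by rewrite ltnSn.
(* For [k > 0] the prefix [latest y k] leaves only the place [y] to exclude, in a level just
   covered. For [k = 0] the prefix is empty and the places below [y] were visited earlier. *)
- have [k0|k0] := posnP k; last first.
    have y0: 0 < y by apply: valid_gt0 Cq; rewrite sq.
    rewrite /leftmost past_head_latest // in zP; have ->: z = y by nat_lia.
    rewrite visit_level eqxx fy ?orbT ?size_latest //.
  have q0 : q = latest y k by rewrite k0; apply: size0nil; rewrite sq.
  rewrite visit_level; have [->|zy] := eqVneq z y; first by rewrite fy ?orbT ?size_latest.
  by rewrite -q0 minV // q0; nat_lia.
- rewrite visit_level V0; last by nat_lia.
  by case: eqVneq => // ?; nat_lia.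
- exact: tight_latest.
- exact: single_latest (size_latest y k) Ce.
exists (T ++ T'); rewrite -visit_cat last_cat lT.
rewrite -[last _ _]/(last (y :: latest y k) T') la'; split=> //.
- by apply: trace_cat => //; rewrite lT.
- move=> z s ss Cs zP; have [zy|zy] := eqVneq z y.
    by rewrite {1}/visit /T visit_level zy eqxx fy ?orbT // -zy.
  by apply: fu' => //; nat_lia.
- move=> z s zP; rewrite ot' ?visit_level; last by nat_lia.
  by case: eqVneq => [zE|]; rewrite ?orbF //; nat_lia.
Qed.

(** The sweep reaches the top: every place open to the last 1 of the rightmost word gives a visited
    word, so the run stops. If [x0.+1 = n], no fresh level is left and it stops at once. *)
Lemma climb_top k n x0 x V q : run_spec k -> x0 < n -> size q = k ->
    valid x0 q -> l k <= x0.+1 -> stuck V x q -> x <= x0 ->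
    (forall z, leftmost q <= z <= x0 -> V (z :: q)) ->
    (forall z s, x0 < z < n -> V (z :: s) = false) -> tight q ->
  exists T, [/\ trace n V (x :: q) T, next_pos n (visit V T) (last (x :: q) T) = None,
    last (x :: q) T = (if x0.+1 == n then x :: q else latest n k.+1),
    forall z s, size s = k -> valid z s -> x0 < z < n -> visit V T (z :: s)
  & forall z s, z <= x0 -> visit V T (z :: s) = V (z :: s)].
Proof.
move=> gk xn sq Cq lx st xx minV V0 aq; case: eqVneq => [nE|nE].
  exists [::]; rewrite visit0; split=> //; last by move=> z s _ _; nat_lia.
  by apply: next_pos_None => // z zP; apply: minV; nat_lia.
have xn1 : x0.+1 < n by nat_lia.
have Cq1 : valid x0.+1 q by apply: valid_leq Cq _.
have := @climb k n n x0.+1 V x q gk (leqnn n) xn1 sq Cq1 lx st.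
case=> [||z s|||T [tr la sT fu ot]].
- by nat_lia.
- by move=> z zP; apply: minV; nat_lia.
- by apply: V0; nat_lia.
- by [].
- exact: single_latest sq Cq.
exists T; split=> //; last by move=> z s zx; apply: ot; nat_lia.
rewrite la (_ : latest n k.+1 = n.-1 :: latest n.-1 k) //; apply: next_pos_None => // z zP.
have [k0|k0] := posnP k.
  have q0 : latest n.-1 k = q by rewrite k0; apply/esym/size0nil; rewrite sq.
  rewrite q0 in zP *; have [zx|zx] := ltnP x0 z.
    by apply: fu; rewrite ?(valid_leq Cq) //; nat_lia.
  by rewrite ot ?minV //; nat_lia.
have Cl : valid n.-1 (latest n.-1 k) by rewrite -sq valid_latest // (valid_leq Cq) //; nat_lia.
have n0 : 0 < n.-1 by apply: valid_gt0 Cl; rewrite size_latest.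
rewrite /leftmost past_head_latest // in zP; have ->: z = n.-1 by nat_lia.
by apply: fu; rewrite ?size_latest //; nat_lia.
Qed.

(** A run never returns to a visited word, so one that ends at its start has made no step and covers
    just that word. *)
Lemma run_latest_single n k t : run n (latest n k) t -> last (latest n k) t = latest n k ->
  full n k (latest n k :: t) -> single n k.
Proof.
case=> tr _ la fu s ss Cs; have := fu s ss Cs.
case: t la tr {fu} => [|u t] la tr; first by rewrite inE => /eqP.
have ut : latest n k \in u :: t by rewrite -{1}la /= mem_last.
by have := trace_notin tr ut; rewrite /= eqxx.
Qed.

(** For odd [k] and [x] above [l k], the prefix at the end of level [x] is [latest x.-1 k]. It
    allows [x.-1] as the smallest place of the last 1 and is rightmost below [x.-1], so the levels
    are swept downwards until [l k]. *)
Lemma descend k n x V q : run_spec k -> odd k -> x < n -> size q = k -> valid x q ->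
    l k <= x -> stuck V x q -> endcond k x q -> (q = latest x k -> single x k) ->
    (forall z s, l k <= z < x -> V (z :: s) = false) ->
  exists T e, [/\ trace n V (x :: q) T /\ last (x :: q) T = l k :: e,
    [/\ size e = k, valid (l k) e, tight e & stuck (visit V T) (l k) e],
    e = latest (l k) k -> single (l k) k,
    forall z s, size s = k -> valid z s -> l k <= z < x -> visit V T (z :: s)
  & forall z s, ~~ (l k <= z < x) -> visit V T (z :: s) = V (z :: s)].
Proof.
move=> gk ok; have k0 : 0 < k by case: (k) ok.
have lk : l k.-1 < l k by rewrite -{2}(prednK k0).
elim: x V q => [|y IH] V q xn sq Cq lx st ec sg V0.
  by have := valid_gt0 _ Cq; rewrite sq k0 => /(_ isT).
have [yl|yl] := eqVneq (l k) y.+1.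
  exists [::], q; rewrite visit0 yl; split=> //; last by move=> z s _ _; nat_lia.
  by case: ec.
case: ec => _; rewrite ok /= => qE; have {}qE : q = latest y k by apply: qE; nat_lia.
have y0 : 0 < y by nat_lia.
have Cy : valid y (latest y k).
  rewrite -sq; apply: (@valid_latest y q).
  by rewrite (valid_le_past_head Cq) // qE past_head_latest.
have [t [rt at_ l1 l2]] := gk _ _ (size_latest y k) Cy.
have [Ce se] := run_last Cy rt; rewrite size_latest in se.
rewrite -qE in rt at_ l1 l2 Ce se.
have fy : full y k (q :: t) by apply: (proj1 at_); rewrite qE tight_latest.
have loq : leftmost q = y by rewrite /leftmost sq qE past_head_latest //; nat_lia.
have [||z|s|] := @jump n V y.+1 q y t st _ _ _ _ rt.
- by rewrite loq; nat_lia.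
- by nat_lia.
- by rewrite loq; nat_lia.
- by apply: V0; nat_lia.
set T := map _ _ => trT stT.
have lT : last (y.+1 :: q) T = y :: last q t by rewrite /T /= last_map.
have [|||||||z s zP|T' [e [[tr' la'] ee sg' fu' ot']]] := IH (visit V T) (last q t).
- by nat_lia.
- by [].
- by [].
- by nat_lia.
- by [].
- exact: l2.
- by move=> h; apply: (@run_latest_single y k t); rewrite -qE // h -qE.
- rewrite visit_level V0; last by nat_lia.
  by case: eqVneq => // ?; nat_lia.
exists (T ++ T'), e; rewrite -visit_cat last_cat lT -[last _ T']/(last (y :: _) T').
split=> //.
- by split=> //; apply: trace_cat => //; rewrite lT.
- move=> z s ss Cs zP; have [zy|zy] := eqVneq z y.
    by rewrite {1}/visit /T visit_level zy eqxx fy ?orbT // -zy.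
  by apply: fu' => //; nat_lia.
- move=> z s zP; rewrite ot' ?visit_level; last by nat_lia.
  by case: eqVneq => [zE|]; rewrite ?orbF //; nat_lia.
Qed.

(** [l] is strictly increasing, so a last 1 at or beyond [l (size r)] exceeds its own bound and, by
    tightness, is adjacent to the 1 before it; this propagates down to the first 1. *)
Lemma tight_past_head r : tight r -> 0 < size r -> l (size r) < past_head r ->
  r = latest (past_head r) (size r).
Proof.
elim: r => //= h r IH; case: eqVneq => [->//|r0] /= /andP[/eqP hE ar] _ lh.
have := ltlS (size r) => ll; rewrite /leftmost in hE.
by rewrite {1}IH ?lt0n ?size_eq0 //; first congr (_ :: latest _ _); nat_lia.
Qed.

(** * Induction on the number of 1's *)

Lemma run_spec0 : run_spec 0.
Proof.
move=> n r /size0nil-> _; exists [::]; split=> //.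
  by split=> // _ s /size0nil-> _; apply: mem_head.
by split=> //=; split=> // _ s /size0nil.
Qed.

(** The start is [x0 :: r], and the run of [r] below [x0] finishes level [x0] with prefix [e]. If
    [r] is not rightmost there, only higher levels follow. If it is, the lower levels are swept
    first, in the direction given by the parity of [k], and then the higher ones. *)
Lemma run_specS k : run_spec k -> run_spec k.+1.
Proof.
move=> gk n [|x0 r] // [sr] /and3P[xn lx Cr]; rewrite sr in lx.
have [t0 [rt0 a0 l1 l2]] := gk _ _ sr Cr.
have [Ce se] := run_last Cr rt0; rewrite sr in se.
move: rt0; set e := last r t0 => rt0.
set T0 := map (cons x0) t0; set V0 := visit (pred1 (x0 :: r)) T0.
have pE : (fun s => pred1 (x0 :: r) (x0 :: s)) = pred1 r.
  by apply: funext => s; rewrite /= eqseq_cons eqxx.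
have tr0 : trace n (pred1 (x0 :: r)) (x0 :: r) T0.
  by apply: trace_map; rewrite pE; case: rt0.
have V0E z s : V0 (z :: s) = (z == x0) && (s \in r :: t0).
  by rewrite /V0 visit_level /= eqseq_cons inE -andb_orr.
have st0 : stuck V0 x0 e.
  rewrite /stuck (_ : (fun s => _) = visit (pred1 r) t0); first by case: rt0.
  by apply: funext => s; rewrite V0E eqxx inE.
have la0 : last (x0 :: r) T0 = x0 :: e by rewrite /= last_map.
have lk : l k < l k.+1 := ltlS k.
(* [T] is the part of the run after level [x0]; coverage is restated level by level, [z] being the
   place of the last 1. *)
suff [T [trT nT fuT lT]] : exists T, [/\ trace n V0 (x0 :: e) T,
    next_pos n (visit V0 T) (last (x0 :: e) T) = None,
    tight (x0 :: r) <-> (forall z s, size s = k -> valid z s -> l k <= z < n ->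
                           visit V0 T (z :: s))
  & if x0 :: r == latest n k.+1 then endcond k.+1 n (last (x0 :: e) T)
    else last (x0 :: e) T = latest n k.+1].
  exists (T0 ++ T); rewrite last_cat la0; split.
  - split; first by apply: trace_cat => //; rewrite la0.
    by rewrite last_cat la0 -visit_cat.
  - rewrite fuT; split=> [h [|z s] // [ss] /and3P[zn lz Cs]|h z s ss Cs /andP[lz zn]].
      have := h z s ss Cs; rewrite ss in lz; rewrite lz zn => /(_ isT).
      by rewrite /V0 visit_cat /visit inE.
    rewrite /V0 visit_cat /visit -[_ || _]/((z :: s) \in (x0 :: r) :: (T0 ++ T)).
    by apply: h; rewrite /= ?ss // zn lz.
  - by move/eqP/negbTE => E; rewrite E in lT.
  - by move/eqP=> E; rewrite E in lT.
have [rE|rN] := eqVneq r (latest x0 k); last first.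
  have k0 : 0 < k.
    by case: k sr rN {gk l1 l2 a0 lx se lk} => //= /size0nil->.
  have eE : e = latest x0 k by apply: l1; apply/eqP.
  have x00 : 0 < x0 by apply: valid_gt0 Cr; rewrite sr.
  have ae : tight e by rewrite eE tight_latest // -eE.
  have [||||T [tr nT la fu ot]] := @climb_top k n x0 x0 V0 e gk xn se Ce _ st0 (leqnn _).
  - by nat_lia.
  - move=> z; rewrite /leftmost se eE past_head_latest // => zx; have ->: z = x0 by nat_lia.
    by rewrite V0E eqxx -eE mem_last.
  - by move=> z s zx; rewrite V0E; case: eqVneq => // ?; nat_lia.
  - by [].
  exists T; split=> //.
  - have r0 : (r == [::]) = false by case: (r) sr k0 => // <-.
    rewrite /= r0 /=; split=> [/andP[/eqP xE ar] z s ss Cs /andP[lz zn]|h].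
      (* Levels below [x0] are never entered, so coverage needs [x0 = l k]. If [x0] were instead
         forced by [past_head r], the 1's of [r] would be adjacent up to [x0] and [r] would be
         rightmost. *)
      have lx0 : l k = x0.
        have := valid_past_head Cr => br; rewrite /leftmost sr in xE.
        have [lb|] := ltnP (l k) (past_head r); last by nat_lia.
        have := tight_past_head ar; rewrite sr => /(_ k0 lb) rE.
        by case/eqP: rN; rewrite {1}rE; congr latest; nat_lia.
      have [zx|zx] := ltnP x0 z; first by apply: fu => //; nat_lia.
      have zE : z = x0 by nat_lia.
      by rewrite ot // V0E zE eqxx (proj1 a0 ar) // -zE.
    have lr : leftmost r <= x0 by rewrite /leftmost sr geq_max lx valid_past_head.
    have ar : tight r.
      apply/a0 => s ss Cs; have := h x0 s ss Cs; rewrite lx xn => /(_ isT).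
      by rewrite ot // V0E eqxx.
    (* Otherwise [leftmost r :: r] is a valid word in a level below [x0], which the run never
       enters. *)
    rewrite ar andbT eqn_leq lr andbT leqNgt; apply/negP => lt.
    have [lb br] : l k <= leftmost r /\ past_head r <= leftmost r by rewrite /leftmost sr; nat_lia.
    have := h (leftmost r) r sr; rewrite (valid_le_past_head Cr) ?ot ?V0E; [|nat_lia|nat_lia].
    by move=> /(_ isT); case: eqVneq => [|_] //=; nat_lia.
  - case: eqP => [[xE rE]|_]; first by case/eqP: rN; rewrite rE xE.
    rewrite la; case: eqP => // nE; rewrite eE -nE //.
(* From here [r] is rightmost below [x0], so [x0 :: r] is tight and full coverage has to be
   shown. *)
have Clat : valid x0.+1 (latest x0.+1 k.+1) by rewrite /= size_latest ltnSn lx -rE.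
have ar : tight r by rewrite rE tight_latest // -rE.
have ax : tight (x0 :: r) by rewrite rE; apply: tight_latest Clat.
have f0 := proj1 a0 ar.
have ec := l2 rE; have ae := proj1 ec.
have sg : e = latest x0 k -> single x0 k.
  by move=> h; apply: (@run_latest_single x0 k t0); rewrite -rE // -/e h rE.
(* After [T1] the levels from [l k] to [x0] are covered, those above are fresh, and the run is stuck
   in level [x1] with tight prefix [q1]. The last clause treats [x0.+1 = n], where the run stops
   here. *)
have [T1 [x1 [q1 [[tr1 la1] [xx sq Cq aq st1] f1 V1 ec1]]]] : exists T1 x1 q1,
    [/\ trace n V0 (x0 :: e) T1 /\ last (x0 :: e) T1 = x1 :: q1,
     [/\ x1 <= x0, size q1 = k, valid x0 q1, tight q1 & stuck (visit V0 T1) x1 q1],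
     forall z s, size s = k -> valid z s -> l k <= z <= x0 -> visit V0 T1 (z :: s),
     forall z s, x0 < z < n -> visit V0 T1 (z :: s) = false
   & x0.+1 = n -> endcond k.+1 n (x1 :: q1)].
  have [ok|ek] := boolP (odd k).
    have [|T1 [q1 [trl [sq Cq aq st1] sg1 fu ot]]] :=
        @descend k n x0 V0 e gk ok xn se Ce lx st0 ec sg.
      by move=> z s zx; rewrite V0E; case: eqVneq => // ?; nat_lia.
    exists T1, (l k), q1; split=> //.
    - by split=> //; apply: valid_leq Cq _.
    - move=> z s ss Cs zP; have [zx|zx] := eqVneq z x0; last by apply: fu => //; nat_lia.
      by rewrite ot ?V0E ?zx ?eqxx ?f0 -?zx //; nat_lia.
    - by move=> z s zP; rewrite ot ?V0E; [case: eqVneq => // ?; nat_lia|nat_lia].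
    - move=> _; rewrite /endcond /= ok /= sq lk Cq leqnn; split.
        have -> : leftmost q1 = l k by rewrite /leftmost sq; have := valid_past_head Cq; nat_lia.
        by rewrite aq eqxx orbT.
      (* If this end word is rightmost below [l k.+1], then [l k.+1 = l k + 1]; the last 1 has a
         single place and [sg1] settles the prefix. *)
      split=> // -[lE qE] [|z s] //= [ss] /and3P[zl lz Cs].
      rewrite ss in lz; have zE : z = l k by nat_lia.
      rewrite zE -lE; congr (_ :: _).
      by apply: sg1 => //; [rewrite {1}qE -lE|rewrite -zE].
  (* For even [k] the prefix [e] lies below [l k]. Unless [l k = x0], the last 1 jumps to its lowest
     place [l k] and the levels up to [x0.-1] are swept upwards, ending at [latest x0 k.+1]. *)
  case: (ec) => _; rewrite (negbTE ek) => -[Cle sge].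
  have [lxE|lxN] := eqVneq (l k) x0.
    exists [::], x0, e; rewrite visit0; split=> //.
    - move=> z s ss Cs zP; have zE : z = x0 by nat_lia.
      rewrite V0E zE eqxx f0 //. by rewrite -zE.
    - by move=> z s zP; rewrite V0E; case: eqVneq => // ?; nat_lia.
    - move=> nE; rewrite /endcond /= ek; split; last by nat_lia.
      have -> : leftmost e = x0 by rewrite /leftmost se lxE;
        apply/maxn_idPl; apply: valid_past_head Ce.
      by rewrite eqxx ae orbT.
  have [|||||||||||T1 [tr la sT fu ot]] := @climb k n x0 (l k) V0 x0 e gk.
  - by nat_lia.
  - by nat_lia.
  - by [].
  - by [].
  - by [].
  - by [].
  - by rewrite leqnn orbT.
  - by move=> z; rewrite /leftmost se; nat_lia.
  - by move=> z s zP; rewrite V0E; case: eqVneq => // ?; nat_lia.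
  - by [].
  - by [].
  have Cl : valid x0 (latest x0 k.+1).
    rewrite /= size_latest; apply/and3P; split; [nat_lia|nat_lia|].
    by rewrite -se; apply: (@valid_latest _ e); apply: valid_leq Cle _; nat_lia.
  have Cl' : valid x0.-1 (latest x0.-1 k) by move: Cl; rewrite /= => /and3P[].
  exists T1, x0.-1, (latest x0.-1 k); split=> //.
  - split; rewrite ?size_latest ?leq_pred ?tight_latest //.
    by apply: valid_leq Cl' _; nat_lia.
  - move=> z s ss Cs zP; have [zx|zx] := eqVneq z x0; last by apply: fu => //; nat_lia.
    by rewrite ot ?V0E ?zx ?eqxx ?f0 -?zx //; nat_lia.
  - by move=> z s zP; rewrite ot ?V0E; [case: eqVneq => // ?; nat_lia|nat_lia].
  - move=> nE; rewrite /endcond /= ek -nE; split=> //.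
    exact: (tight_latest Cl).
have [||||T [tr nT la fu ot]] := @climb_top k n x0 x1 _ q1 gk xn sq Cq _ st1 xx.
- by nat_lia.
- move=> z; rewrite /leftmost sq => zP; apply: f1 => //; last by nat_lia.
  by apply: valid_le_past_head Cq _; nat_lia.
- exact: V1.
- by [].
rewrite visit_cat in nT fu ot.
exists (T1 ++ T); rewrite last_cat la1; split=> //.
- by apply: trace_cat => //; rewrite la1.
- split=> // _ z s ss Cs zP; have [zx|zx] := ltnP x0 z.
    by apply: fu => //; nat_lia.
  by rewrite ot ?f1 //; nat_lia.
- rewrite la; have [nE|nE] := eqVneq x0.+1 n.
    by rewrite rE -nE eqxx nE; apply: ec1.
  by case: eqP => // -[xE _]; rewrite xE prednK ?eqxx // in nE; nat_lia.
Qed.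

Lemma run_specP k : run_spec k.
Proof. by elim: k => [|k IH]; [apply: run_spec0|apply: run_specS]. Qed.

End Positions.

(** * Position lists and binary words *)

(* Strictly decreasing lists [r] of naturals below [n]: the bound
   [size r' <= x] in [valid id] is automatic for those. *)
Notation decreasing n r := (valid id n r).

Fixpoint word n (r : seq nat) : seq bool :=
  if r is x :: r' then word x r' ++ true :: nseq (n - x.+1) false
  else nseq n false.

Lemma size_word n r : decreasing n r -> size (word n r) = n.
Proof.
elim: r n => [|x r IH] n /=; first by rewrite size_nseq.
by case/and3P=> xn _ /IH E; rewrite size_cat /= size_nseq E; lia.
Qed.

Lemma decreasing_cons n x r : decreasing n (x :: r) = (x < n) && decreasing x r.
Proof.
rewrite /=; case Cr: (decreasing x r); rewrite ?andbF //.
by rewrite (valid_size Cr).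
Qed.

Lemma decreasing_ltn n r i : decreasing n r -> i \in r -> i < n.
Proof.
elim: r n => // x r IH n; rewrite decreasing_cons => /andP[xn Cr].
rewrite inE => /predU1P[->//|/(IH _ Cr)]; lia.
Qed.

Lemma nth_word n r i : decreasing n r -> nth false (word n r) i = (i \in r).
Proof.
elim: r n => [|x r IH] n; first by rewrite /= nth_nseq if_same.
rewrite decreasing_cons /= => /andP[xn Cr]; rewrite nth_cat size_word // inE.
have [ix|ix] := ltnP i x; first by rewrite IH // ltn_eqF.
have -> : (i \in r) = false.
  by apply/negP => /(decreasing_ltn Cr); rewrite ltnNge ix.
rewrite orbF; have [->|ne] := eqVneq i x; first by rewrite subnn.
have -> : i - x = (i - x.+1).+1 by lia.
by rewrite /= nth_nseq if_same.
Qed.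

Lemma word_inj n r s : decreasing n r -> decreasing n s -> word n r = word n s -> r = s.
Proof.
move=> Cr Cs E; have srt q m : decreasing m q -> path (fun a b => b < a) m q.
  elim: q m => // x q IH m; rewrite decreasing_cons => /andP[xm /IH] /=.
  by rewrite xm.
apply: (@irr_sorted_eq _ (fun a b => b < a)).
- by move=> a b c h1 h2; apply: ltn_trans h2 h1.
- by move=> a; rewrite /= ltnn.
- exact: path_sorted (srt _ _ Cr).
- exact: path_sorted (srt _ _ Cs).
by move=> i; rewrite -(nth_word _ Cr) E nth_word.
Qed.

Lemma word_onto w : exists2 r, decreasing (size w) r & word (size w) r = w.
Proof.
elim/last_ind: w => [|w b [r Cr wE]]; first by exists [::].
rewrite size_rcons; case: b.
  exists (size w :: r); first by rewrite decreasing_cons ltnSn.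
  by rewrite /= wE subnn cats1.
exists r; first by apply: valid_leq Cr _.
rewrite -[in RHS]wE -cats1; case: r Cr {wE} => [_|x r].
  by rewrite /= -[[:: false]]/(nseq 1 false) -nseqD addn1.
rewrite decreasing_cons => /andP[xn _]; rewrite /= -catA /= subSn //.
by congr (_ ++ _ :: _); rewrite -[[:: false]]/(nseq 1 false) -nseqD addn1.
Qed.

(** * Homogeneous transpositions as moves of positions *)

Lemma nth_swap w i j m : nth false (swap w i j) m =
  if m == j then nth false w i else if m == i then nth false w j
  else nth false w m.
Proof. by rewrite /swap !nth_set_nth /= nth_set_nth /=. Qed.

Lemma size_swap w i j : i < size w -> j < size w -> size (swap w i j) = size w.
Proof. by move=> iw jw; rewrite /swap !size_set_nth; lia. Qed.

Lemma homog_word n r i j : decreasing n r ->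
  homog (word n r) i j = [&& j < n, i \in r, j \notin r
    & all (fun m => m \notin r) (iota (minn i j).+1 (maxn i j - minn i j).-1)].
Proof.
move=> Cr; rewrite /homog size_word // !nth_word //.
have [ir|] := boolP (i \in r); last by rewrite !andbF.
rewrite (decreasing_ltn Cr ir) /=; congr [&& _, _ & _].
by apply: eq_all => m; rewrite nth_word.
Qed.

Definition swaps_at w n i := [seq swap w i j | j <- iota 0 n & homog w i j].

Definition moves w :=
  [seq swap w ij.1 ij.2 | ij <- pairs (size w) & homog w ij.1 ij.2].

Lemma moves_flatten w : moves w = flatten [seq swaps_at w (size w) i | i <- iota 0 (size w)].
Proof.
rewrite /moves /pairs; move: {2 3}(iota 0 _) => s.
elim: s => //= i s IH; rewrite filter_cat map_cat IH filter_map -map_comp.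
by [].
Qed.

(** The previous 1 blocks every target to its left; after it the only 1 is at [x], so all other
    places are allowed. *)
Lemma swaps_at_head n x r : decreasing n (x :: r) ->
  swaps_at (word n (x :: r)) n x =
  [seq word n (y :: r) | y <- iota (past_head r) (n - past_head r) & y != x].
Proof.
move=> Cx; have := Cx; rewrite decreasing_cons => /andP[xn Cr].
have bx := valid_past_head Cr.
have nE : iota 0 n = iota 0 (past_head r) ++ iota (past_head r) (n - past_head r).
  by rewrite -iotaD subnKC // (leq_trans bx) // ltnW.
rewrite /swaps_at nE filter_cat map_cat.
rewrite (_ : filter _ (iota 0 _) = [::]) ?cat0s; last first.
  apply/eqP; rewrite -size_eq0 size_filter -leqn0 leqNgt -has_count.
  apply/hasPn => j; rewrite mem_iota add0n homog_word // => jb.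
  apply/negP => /and4P[_ _ jN /allP/=].
  case: r {Cx nE} Cr bx jb jN => //= h r Cr hx jh; rewrite !inE !negb_or => /and3P[jx jh' _].
  move/(_ h); rewrite mem_iota !inE eqxx orbT /= => H.
  by have : false by apply: H; lia.
rewrite (@eq_in_filter _ _ (fun y => y != x)); last first.
  move=> j; rewrite mem_iota homog_word // mem_head /= => jP.
  rewrite !inE negb_or (_ : j < n) /=; last by lia.
  have Nr m : past_head r <= m -> m \notin r.
    move=> bm; have Cb : decreasing (past_head r) r by apply: valid_le_past_head Cr _.
    by apply/negP => /(decreasing_ltn Cb); lia.
  rewrite Nr ?andbT /=; last by lia.
  case: eqVneq => //= jx; apply/allP => m; rewrite mem_iota inE negb_or => mP.
  by rewrite Nr ?andbT; lia.
apply/eq_in_map => j; rewrite mem_filter mem_iota => /andP[jx jP].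
have jn : j < n by lia.
have Cj : decreasing n (j :: r) by rewrite decreasing_cons jn (valid_le_past_head Cr) //; lia.
apply: (@eq_from_nth _ false); rewrite ?size_swap ?size_word // => m mn.
rewrite nth_swap !nth_word // !inE eqxx.
have [->|mj] := eqVneq m j; rewrite ?eqxx //=.
have [->|mx] := eqVneq m x; last by [].
rewrite (negbTE jx) /=; have Cb : decreasing (past_head r) r by apply: valid_le_past_head Cr _.
have -> : (j \in r) = false by apply/negP => /(decreasing_ltn Cb); lia.
by symmetry; apply/negP => /(decreasing_ltn Cr); rewrite ltnn.
Qed.

(** The 1 at [x] blocks every target to its right, so the swap stays inside the prefix and the tail
    is carried along. *)
Lemma swaps_at_prefix n x r i : decreasing n (x :: r) -> i < x ->
  swaps_at (word n (x :: r)) n i =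
  [seq u ++ true :: nseq (n - x.+1) false | u <- swaps_at (word x r) x i].
Proof.
move=> Cx ix; have := Cx; rewrite decreasing_cons => /andP[xn Cr].
have hE j : homog (word n (x :: r)) i j = (j < x) && homog (word x r) i j.
  rewrite !homog_word // !inE (ltn_eqF ix) /= !negb_or.
  case: (ltngtP j x) => [jx|jx|_].
  - rewrite (ltn_trans jx xn) /=; congr [&& _, _ & _].
    apply: eq_in_all => m; rewrite mem_iota inE negb_or => mP.
    by rewrite (_ : m != x) //; lia.
  - apply/negP => /and4P[_ _ _ /allP/(_ x)].
    by rewrite mem_iota mem_head /= => H; have : false by apply: H; lia.
  - by rewrite !andbF.
have nE : iota 0 n = iota 0 x ++ iota x (n - x) by rewrite -iotaD subnKC // ltnW.
rewrite /swaps_at nE filter_cat map_cat.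
rewrite [X in _ ++ map _ X](_ : _ = [::]) ?cats0; last first.
  apply/eqP; rewrite -size_eq0 size_filter -leqn0 leqNgt -has_count.
  by apply/hasPn => j; rewrite mem_iota hE; lia.
rewrite -map_comp (@eq_in_filter _ _ (homog (word x r) i)); last first.
  by move=> j; rewrite mem_iota hE; case: ltnP.
apply/eq_in_map => j; rewrite mem_filter mem_iota => /andP[_ jx].
apply: (@eq_from_nth _ false); rewrite ?size_swap ?size_word //=; try lia.
  by rewrite size_cat /= size_nseq size_swap size_word //; lia.
move=> m mn; rewrite nth_swap !nth_cat nth_swap size_swap ?size_word; try lia; try done.
rewrite ix (_ : j < x); last by lia.
by have [mx|mx] := ltnP m x; case: (m =P j) => // ?; case: (m =P i) => // ?; lia.
Qed.

Lemma flatten_nil (T : eqType) (S : Type) (f : T -> seq S) s :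
  (forall i, i \in s -> f i = [::]) -> flatten (map f s) = [::].
Proof.
elim: s => //= i s IH f0; rewrite f0 ?mem_head // IH // => j js.
by rewrite f0 // inE js orbT.
Qed.

Lemma swaps_at_nil w n i : ~~ nth false w i -> swaps_at w n i = [::].
Proof.
move=> wi; rewrite /swaps_at (_ : filter _ _ = [::]) //; apply/eqP.
rewrite -size_eq0 size_filter -leqn0 leqNgt -has_count.
by apply/hasPn => j _; rewrite /homog (negbTE wi) !andbF.
Qed.

(** With the bound [id] a list is merely strictly decreasing, so [moves_pos id] gives all
    homogeneous transpositions, in the order in which the algorithm tries them. *)
Lemma moves_word n r : decreasing n r ->
  moves (word n r) = [seq word n s | s <- moves_pos id n r].
Proof.
move=> Cr; rewrite moves_flatten size_word //.
elim: r n Cr => [|x r IH] n Cx.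
  by apply: flatten_nil => i _; rewrite swaps_at_nil // nth_word.
have := Cx; rewrite decreasing_cons => /andP[xn Cr].
have bx := valid_past_head Cr.
have sb : size r <= past_head r by apply: valid_size (valid_le_past_head Cr _).
have nE : n = x + (n - x.+1).+1 by lia.
(* Positions are split into those before [x], [x] itself and those after it; the last carry no 1. *)
rewrite {3}nE iotaD map_cat flatten_cat [iota (0 + x) _]/= map_cons add0n.
rewrite -[flatten (_ :: _)]/(_ ++ flatten _) swaps_at_head //.
rewrite [flatten (map _ (iota x.+1 _))]flatten_nil ?cats0; last first.
  move=> i; rewrite mem_iota => iP; rewrite swaps_at_nil // nth_word //.
  by apply/negP; rewrite inE => /predU1P[|/(decreasing_ltn Cr)]; lia.
rewrite [moves_pos _ _ _]/= map_cat -!map_comp /leftmost (maxn_idPr sb); congr (_ ++ _).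
rewrite [RHS](_ : _ = [seq u ++ true :: nseq (n - x.+1) false
                        | u <- [seq word x s | s <- moves_pos id x r]]); last first.
  by rewrite -map_comp; apply: eq_map.
rewrite -IH // map_flatten -map_comp; congr flatten.
by apply/eq_in_map => i; rewrite mem_iota => ix; rewrite swaps_at_prefix //; lia.
Qed.

(** * The greedy algorithm on words and the list of tight words *)

Section Greedy.

Variable l : nat -> nat.
Hypothesis ltlS : forall i, l i < l i.+1.

Lemma valid_decreasing n r : valid l n r -> decreasing n r.
Proof.
elim: r n => // x r IH n /and3P[xn _ Cr].
by rewrite decreasing_cons xn IH.
Qed.

(** Moving a prefix 1 leaves the last 1 valid, and moving the last 1 only tests its own bound, which
    cuts off an initial segment of the targets. *)
Lemma filter_moves_pos n r : valid l n r ->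
  [seq s <- moves_pos id n r | valid l n s] = moves_pos l n r.
Proof.
elim: r n => // x r IH n Cx; have := Cx => /and3P[xn lx Cr].
rewrite [moves_pos id n _]/= [moves_pos l n _]/= filter_cat; congr (_ ++ _).
  rewrite filter_map -IH //; congr map; apply: eq_in_filter => s.
  by case/(moves_pos_valid (valid_decreasing Cr))/andP => _ /eqP sE; rewrite /= sE xn lx.
rewrite filter_map -filter_predI.
have bx := valid_past_head Cr.
have sb : size r <= past_head r by apply: valid_size (valid_le_past_head Cr _).
have -> : leftmost id r = past_head r by rewrite /leftmost (maxn_idPr sb).
have lon : leftmost l r <= n by rewrite /leftmost geq_max; lia.
have -> : n - past_head r = (leftmost l r - past_head r) + (n - leftmost l r) by rewrite /leftmost; lia.
rewrite iotaD filter_cat.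
rewrite [X in _ ++ filter _ X](_ : _ = iota (leftmost l r) (n - leftmost l r)); last first.
  by congr iota; rewrite /leftmost; lia.
rewrite (_ : filter _ (iota (past_head r) _) = [::]) /=; last first.
  apply/eqP; rewrite -size_eq0 size_filter -leqn0 leqNgt -has_count.
  by apply/hasPn => y; rewrite mem_iota /leftmost /= => yP; lia.
congr map; apply: eq_in_filter => y; rewrite mem_iota /leftmost /= => yP.
have -> : y < n by lia.
by rewrite (valid_le_past_head Cr) ?andbT; lia.
Qed.

Variables (S : pred (seq bool)) (n k : nat).
Hypothesis S_word : forall s, decreasing n s -> S (word n s) = (size s == k) && valid l n s.

Lemma mem_map_word L s : all (valid l n) L -> valid l n s ->
  (word n s \in map (word n) L) = (s \in L).
Proof.
move=> /allP CL Cs; apply/mapP/idP => [[u uL /word_inj->]|sL]; last by exists s.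
- by [].
- exact: valid_decreasing.
- by apply: valid_decreasing; apply: CL.
Qed.

Lemma ohead_map (T U : Type) (f : T -> U) s : ohead (map f s) = omap f (ohead s).
Proof. by case: s. Qed.

Lemma greedy_next_word L r : all (valid l n) L -> valid l n r -> size r = k ->
  greedy_next S (map (word n) L) (word n r) =
  omap (word n) (next_pos l n (fun s => s \in L) r).
Proof.
move=> CL Cr sr; have Dr := valid_decreasing Cr.
have -> : greedy_next S (map (word n) L) (word n r) =
    ohead [seq u <- moves (word n r) | S u && (u \notin map (word n) L)].
  rewrite /greedy_next /moves filter_map -filter_predI; congr (ohead (map _ _)).
  by apply: eq_filter => ij /=; rewrite andbC.
rewrite moves_word // filter_map ohead_map /next_pos -filter_moves_pos // -filter_predI.
congr (omap _ (ohead _)); apply: eq_in_filter => s /(moves_pos_valid Dr)/andP[Ds /eqP sE] /=.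
rewrite S_word // sE sr eqxx /= andbC; case Cs: (valid l n s); rewrite ?andbF //.
by rewrite mem_map_word.
Qed.

Lemma greedy_aux_trace f L r t : all (valid l n) L -> valid l n r -> size r = k ->
    trace l n (fun s => s \in L) r t ->
    next_pos l n (visit (fun s => s \in L) t) (last r t) = None -> size t <= f ->
  greedy_aux S f (map (word n) L) (word n r) = map (word n) (L ++ t).
Proof.
elim: f L r t => [|f IH] L r [|s t] //= CL Cr sr tr nt st; rewrite ?cats0 //.
  by rewrite greedy_next_word //; move: nt; rewrite visit0 => ->.
case: tr => ns tr; rewrite greedy_next_word // ns /=.
have [/(moves_pos_valid Cr)/andP[Cs /eqP sE] _] := next_pos_Some ns.
have extE : visit (fun u => u \in L) [:: s] = (fun u => u \in rcons L s).
  by apply: funext => u; rewrite /visit mem_rcons !inE orbC.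
rewrite -cat_rcons -map_rcons; apply: IH => //.
- by rewrite all_rcons Cs.
- by rewrite sE.
- by rewrite -extE.
- by rewrite -extE visit_cat.
Qed.

(** The words of a trace are distinct and of length [n], so the fuel of [greedy] suffices. *)
Lemma size_trace r t : valid l n r -> trace l n (pred1 r) r t -> size t <= 2 ^ n.
Proof.
move=> Cr tr; have Ct s : s \in t -> valid l n s.
  by move=> st; case: (trace_valid Cr tr (s := s)) => //; rewrite inE st orbT.
have: uniq (map (word n) t).
  rewrite map_inj_in_uniq ?(trace_uniq tr) // => s u /Ct Cs /Ct Cu.
  by apply: word_inj; apply: valid_decreasing.
have sz w : w \in map (word n) t -> size w == n.
  by case/mapP=> s /Ct Cs ->; rewrite size_word //; apply: valid_decreasing.
move=> ut; rewrite -(size_map (word n)) -card_bool -card_tuple.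
have -> : size (map (word n) t) =
    size (pmap (insub : _ -> option (n.-tuple bool)) (map (word n) t)).
  rewrite size_pmap_sub; apply/esym/eqP; rewrite -all_count.
  by apply/allP.
by rewrite cardT -(card_uniqP (pmap_sub_uniq _ ut)) -cardT max_card.
Qed.

(** The greedy list is the image of the run from [r], so by [run_specP] generating everything
    amounts to tightness. *)
Lemma greedy_word r : valid l n r -> size r = k ->
  (forall s, size s = k -> valid l n s -> word n s \in greedy S (word n r)) <-> tight l r.
Proof.
move=> Cr sr; have [t [[tr nt] at_ _ _]] := run_specP ltlS sr Cr.
have p1 : (fun s => s \in [:: r]) = pred1 r :> (seq nat -> bool).
  by apply: funext => s; rewrite inE.
have -> : greedy S (word n r) = map (word n) (r :: t).
  rewrite /greedy size_word ?(valid_decreasing Cr) // -[[:: word n r]]/(map (word n) [:: r]).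
  apply: (@greedy_aux_trace _ [:: r] r t); rewrite ?p1 ?(size_trace Cr tr) //.
  by rewrite /= Cr.
rewrite at_; have Ct : all (valid l n) (r :: t).
  by apply/allP => s /(trace_valid Cr tr)[].
by split=> h s ss Cs; have := h s ss Cs; rewrite mem_map_word.
Qed.

(** The tight list with first 1 at [a] and [i] further 1's, all of them forced. *)
Fixpoint earliest i a := if i is j.+1 then leftmost l (earliest j a) :: earliest j a else [:: a].

Lemma size_earliest i a : size (earliest i a) = i.+1.
Proof. by elim: i => //= i ->. Qed.

Lemma last_earliest i a : last 0 (earliest i a) = a.
Proof. by case: i => //= i; elim: i => //=. Qed.

Lemma tight_earliest i a : tight l (earliest i a).
Proof. by elim: i => //= i ->; rewrite eqxx orbT. Qed.

(** [l] grows by at least one per step, so once [l i] reaches the place [i + a] in an unbroken block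
    from [a], it stays at or above it. The last 1 sits at the larger of the two. *)
Lemma past_head_earliest i a : l 0 <= a ->
  past_head (earliest i a) = (maxn (l i) (i + a)).+1 /\
  valid l (past_head (earliest i a)) (earliest i a).
Proof.
move=> la; elim: i => [|i [bE Ci]]; first by rewrite /= la ltnSn; lia.
have loE : leftmost l (earliest i a) = maxn (l i.+1) (maxn (l i) (i + a)).+1.
  by rewrite /leftmost size_earliest bE.
have := ltlS i; rewrite /= ltnSn size_earliest loE => li.
by rewrite leq_maxl (valid_le_past_head Ci) ?bE ?leq_maxr //; split=> //; lia.
Qed.

Lemma tightP r i : size r = i.+1 -> tight l r -> r = earliest i (last 0 r).
Proof.
elim: i r => [|i IH] [|x [|y r]] //= [sr] /andP[/eqP xE ar].
by rewrite xE /= [earliest i _](_ : _ = y :: r) //; symmetry;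
  apply: (IH (y :: r)) => //=; rewrite sr.
Qed.

Lemma valid_last r : valid l n r -> 0 < size r -> l 0 <= last 0 r.
Proof.
elim: r n => //= x [|y r] IH m /and3P[_ lx Cr] _ //.
exact: (IH x Cr).
Qed.

End Greedy.

(** * The ballot condition *)

Section Words.
Variables (R : realType) (p : R).
Hypothesis p0 : (0 <= p)%R.

(** A 1 at [x] with [i] 1's before it is preceded by [x - i] 0's, which must be at least [p * i.+1].
    The ceiling is nonnegative for [p >= 0]; the absolute value only makes it a natural number. *)
Definition ballot_bound i := i + `|Num.ceil (p * i.+1%:R)|.

Lemma ceil_mulrn_ge0 i : (0 <= Num.ceil (p * i%:R))%R.
Proof. by rewrite ceil_ge0 (lt_le_trans (ltrN10 R)) // mulr_ge0. Qed.

Lemma ballot_bound_lt i : ballot_bound i < ballot_bound i.+1.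
Proof.
rewrite /ballot_bound; have : (Num.ceil (p * i.+1%:R) <= Num.ceil (p * i.+2%:R))%R.
  by apply: le_ceil; rewrite ler_wpM2l // ler_nat.
have := ceil_mulrn_ge0 i.+1; move: (Num.ceil _) (Num.ceil _) => a b; lia.
Qed.

Lemma ballot_bound_le i x : i <= x ->
  (ballot_bound i <= x) = (p * i.+1%:R <= (x - i)%:R)%R.
Proof.
move=> ix; rewrite -[(x - i)%:R%R]/((Posz (x - i))%:~R)%R -ceil_le_int /ballot_bound.
by have := ceil_mulrn_ge0 i.+1; move: (Num.ceil _) => a; lia.
Qed.

Definition ballot w :=
  all (fun m => p * (weight (take m w))%:R <= (zeros (take m w))%:R)%R
      (iota 0 (size w).+1).

Lemma ballotP w :
  reflect (forall m, m <= size w ->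
             (p * (weight (take m w))%:R <= (zeros (take m w))%:R)%R)
          (ballot w).
Proof.
apply: (iffP allP) => h m; last by rewrite mem_iota => mP; apply: h; lia.
by move=> mw; apply: h; rewrite mem_iota; lia.
Qed.

Lemma weight_cat u v : weight (u ++ v) = weight u + weight v.
Proof. exact: count_cat. Qed.

Lemma zeros_cat u v : zeros (u ++ v) = zeros u + zeros v.
Proof. exact: count_cat. Qed.

Lemma weight_nseq0 m : weight (nseq m false) = 0.
Proof. by rewrite /weight count_nseq. Qed.

Lemma zeros_nseq0 m : zeros (nseq m false) = m.
Proof. by rewrite /zeros count_nseq mul1n. Qed.

Lemma weight_word n r : weight (word n r) = size r.
Proof.
elim: r n => [|x r IH] n /=; first exact: weight_nseq0.
by rewrite weight_cat IH -[true :: _]/([:: true] ++ _) weight_cat weight_nseq0 /=; lia.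
Qed.

Lemma zeros_word n r : decreasing n r -> zeros (word n r) = n - size r.
Proof.
move=> Dr; rewrite -{2}(size_word Dr) -(weight_word n r) /weight /zeros.
by rewrite -(count_predC id) addKn.
Qed.

(** Only prefixes ending in a 1 matter, because appending 0's preserves the inequality. *)
Lemma ballot_word n r : decreasing n r -> ballot (word n r) = valid ballot_bound n r.
Proof.
elim: r n => [|x r IH] n Dx.
  apply/ballotP => m mn /=; rewrite (_ : take m _ = nseq m false).
    by rewrite weight_nseq0 mulr0 ler0n.
  by move: mn; rewrite /= size_nseq => mn; rewrite take_nseq.
have := Dx; rewrite decreasing_cons => /andP[xn Dr].
have sx : size r <= x by apply: valid_size Dr.
rewrite [valid _ _ _]/= xn -IH // ballot_bound_le //=.
have tl m : m <= x -> take m (word x r ++ true :: nseq (n - x.+1) false) = take m (word x r).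
  by move=> mx; rewrite takel_cat // size_word.
have hd m : m <= n - x.+1 ->
    take (x + m.+1) (word x r ++ true :: nseq (n - x.+1) false) =
    word x r ++ true :: nseq m false.
  move=> mn; rewrite takeD take_size_cat ?size_word // drop_size_cat ?size_word //=.
  by rewrite take_nseq.
have hdE m : m <= n - x.+1 ->
    weight (word x r ++ true :: nseq m false) = (size r).+1 /\
    zeros (word x r ++ true :: nseq m false) = x - size r + m.
  move=> mn; rewrite weight_cat zeros_cat weight_word zeros_word //.
  rewrite -[true :: _]/([:: true] ++ _) weight_cat zeros_cat weight_nseq0 zeros_nseq0 /=.
  by split; lia.
have sw : size (word n (x :: r)) = n by rewrite size_word.
rewrite /= in sw; apply/ballotP/andP => [h|[h1 /ballotP h2] m].
  split; last by apply/ballotP => m; rewrite size_word // => mx; rewrite -tl // h // sw; lia.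
  have := h (x + 1); have [wE zE] := hdE 0 (leq0n _).
  by rewrite sw hd // wE zE addn0; apply; lia.
rewrite sw => mn; have [mx|mx] := leqP m x; first by rewrite tl // h2 // size_word.
have -> : m = x + (m - x.+1).+1 by lia.
have mn' : m - x.+1 <= n - x.+1 by lia.
have [wE zE] := hdE _ mn'; rewrite hd // wE zE.
by apply: le_trans h1 _; rewrite ler_nat leq_addr.
Qed.

Lemma inC_word n k r : decreasing n r ->
  inC p n k (word n r) = (size r == k) && valid ballot_bound n r.
Proof.
by move=> Dr; rewrite -ballot_word // /inC /ballot size_word // eqxx weight_word.
Qed.

End Words.

(** * Counting the tight words by the place of their first 1 *)

Theorem theorem4 (R : realType) (p : R) (k n : nat) :
  (0 <= p)%R -> (1 <= k)%N -> ((p + 1) * k%:R <= n%:R)%R ->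
  (#|Gen p n k|%:Z = n%:Z - k%:Z + 1 - Num.ceil p)%R.
Proof.
(* From here [k] is one less than the number of 1's. *)
move=> p0; case: k => // k _ hn.
pose l := ballot_bound p.
have ltlS : forall i, l i < l i.+1 := ballot_bound_lt p0.
have lkn : l k < n.
  have kn : k.+1 <= n.
    rewrite -(ler_nat R); apply: le_trans hn.
    by rewrite ler_peMl ?ler0n // lerDr.
  have : (p * k.+1%:R <= (n.-1 - k)%:R)%R.
    rewrite natrB ?lerBrDr; last by lia.
    rewrite mulrDl mul1r in hn.
    apply: le_trans (_ : n.-1.+1%:R - 1 <= _)%R; last by rewrite -natr1 addrK.
    by rewrite lerBrDr -addrA natr1 prednK // (leq_trans _ kn).
  by rewrite -(ballot_bound_le p0) /l; lia.
have l0 : ((l 0%N)%:Z = Num.ceil p)%R.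
  by rewrite /l /ballot_bound mulr1; have := ceil_mulrn_ge0 p0 1; rewrite mulr1; lia.
(* The first 1 of a tight word ranges from [l 0] to [n - k.+1], as [k] more 1's must follow it; [m]
   counts these places. *)
pose m := n - k - l 0.
have lm i : l 0 + i < n - k <-> i < m by rewrite /m; lia.
(* The all-zero default is never returned, since the word has length [n]. *)
pose f (i : 'I_m) : n.-tuple bool := insubd (nseq_tuple n false) (word n (earliest l k (l 0 + i))).
have Calf (i : 'I_m) : valid l n (earliest l k (l 0 + i)).
  have [bE Cb] := past_head_earliest ltlS k (leq_addr i (l 0)).
  apply: valid_leq Cb _; have := proj2 (lm i) (ltn_ord i); rewrite bE; lia.
have valf (i : 'I_m) : val (f i) = word n (earliest l k (l 0 + i)).
  by rewrite /f val_insubd size_word ?eqxx // (valid_decreasing (Calf i)).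
have Sw s : decreasing n s -> inC p n k.+1 (word n s) = (size s == k.+1) && valid l n s.
  exact: inC_word.
have f_inj : injective f.
  move=> i j /(congr1 val); rewrite !valf => /word_inj E; apply/val_inj.
  have /(congr1 (last 0)) := E (valid_decreasing (Calf i)) (valid_decreasing (Calf j)).
  by rewrite !last_earliest => /addnI.
have -> : Gen p n k.+1 = [set f i | i : 'I_m].
  apply/setP => a; rewrite inE; apply/andP/imsetP => [[Ca /forallP fa]|[i _ ->]].
    have [r Dr wE] := word_onto a; rewrite size_tuple in Dr wE.
    move: Ca; rewrite -wE Sw // => /andP[/eqP sr Cr].
    have ar : tight l r.
      apply/(greedy_word ltlS Sw Cr sr) => s ss Cs.
      have Ds := valid_decreasing Cs; have sws : size (word n s) == n by rewrite size_word.
      have /implyP := fa (Tuple sws); rewrite /= Sw // ss eqxx Cs => /(_ isT).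
      by rewrite /Dp wE.
    have rE := tightP sr ar.
    have l0r : l 0 <= last 0 r by apply: valid_last Cr _; rewrite sr.
    have im : last 0 r - l 0 < m.
      apply/lm; rewrite subnKC //; have [bE _] := past_head_earliest ltlS k l0r.
      by have := valid_past_head Cr; rewrite rE bE last_earliest; lia.
    exists (Ordinal im) => //; apply/val_inj; rewrite valf /= subnKC // -rE.
    by rewrite wE.
  split; first by rewrite valf Sw ?(valid_decreasing (Calf i)) // size_earliest eqxx Calf.
  apply/forallP => w; apply/implyP => Cw; rewrite /Dp valf.
  have [r Dr wE] := word_onto w; rewrite size_tuple in Dr wE.
  move: Cw; rewrite -wE Sw // => /andP[/eqP sr Cr].
  have h := proj2 (greedy_word ltlS Sw (Calf i) (size_earliest _ _ _)) (tight_earliest _ _ _).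
 by rewrite [val w](esym wE); apply: h.
rewrite card_imset // card_ord -l0 /m.
(* With [l k < n] this makes the truncated subtraction in [m] exact. *)
have : l 0 + k <= l k by elim: (k) => [|j]; [lia|have := ltlS j; lia].
lia.
Qed.
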